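(* Let $(\mathcal M,[\,,\,],\langle\,,\,\rangle)$ be a flat Euclidean solvable Malcev algebra. Then $(\mathcal M,[\,,\,],\langle\,,\,\rangle)$ is a flat Euclidean Lie algebra, i.e. $(\mathcal M,[\,,\,])$ is a Lie algebra and $(\mathcal M,[\,,\,],\langle\,,\,\rangle)$ is flat as a Lie algebra ($K_0=0$).
   Context: All vector spaces are finite dimensional; here the base field is $\mathbb R$. A Malcev algebra is a vector space $\mathcal M$ with an anti-symmetric bilinear bracket satisfying $J(u,v,[u,w])=[J(u,v,w),u]$ for all $u,v,w$, where $J(u,v,w)=[[u,v],w]+[[w,u],v]+[[v,w],u]$. A Euclidean Malcev algebra is a real Malcev algebra with a positive definite symmetric bilinear form $\langle\,,\,\rangle$. The Levi-Civita product $\bullet$ is defined by $2\langle u\bullet v,w\rangle=\langle[u,v],w\rangle-\langle[v,w],u\rangle+\langle[w,u],v\rangle$, and $\mathrm L_u(v)=u\bullet v$. The Malcev algebra is flat if $K=0$, where $$K(u,v,w)=\mathrm L_{[[u,v],w]}-\mathrm L_{[u,w]}\circ\mathrm L_v-\mathrm L_u\circ\mathrm L_{[v,w]}+\mathrm L_v\circ\mathrm L_u\circ\mathrm L_w-\mathrm L_w\circ\mathrm L_v\circ\mathrm L_u.$$ A Lie algebra with a non-degenerate symmetric bilinear form is flat as a Lie algebra if $K_0(u,v):=\mathrm L_{[u,v]}-[\mathrm L_u,\mathrm L_v]=0$ for all $u,v$, where $\mathrm L$ is again left multiplication for the Levi-Civita product. *)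

(* Defs.v *)
From HB Require Import structures.
From mathcomp Require Import all_boot all_order all_algebra.
From mathcomp Require Import boolp classical_sets reals.
From mathcomp Require Import ring.

Set Implicit Arguments.
Unset Strict Implicit.
Unset Printing Implicit Defensive.

Import Order.TTheory GRing.Theory Num.Theory.
Local Open Scope ring_scope.

Section Algebras.
Variables (R : realType) (M : vectType R).
Variable br : {bilinear M -> M -> M}.

Definition anticommutative := forall u v : M, br u v = - br v u.

Definition jacobian (u v w : M) : M :=
  br (br u v) w + br (br w u) v + br (br v w) u.

Definition malcev_algebra :=
  anticommutative /\
  (forall u v w : M, jacobian u v (br u w) = br (jacobian u v w) u).

Definition lie_algebra :=
  anticommutative /\ (forall u v w : M, jacobian u v w = 0).

(* [U, W] is the span of all brackets; bases suffice, see bracketv_subP. *)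
Definition bracketv (U W : {vspace M}) : {vspace M} :=
  <<[seq br u w | u <- vbasis U, w <- vbasis W]>>%VS.

Lemma memv_bracket (U W : {vspace M}) (u w : M) :
  u \in U -> w \in W -> br u w \in bracketv U W.
Proof.
move=> Uu Ww; rewrite (coord_vbasis Uu) (coord_vbasis Ww).
rewrite linear_sumlz rpred_sum // => i _.
rewrite linear_sumr rpred_sum // => j _.
rewrite linearZl_LR linearZr_LR /= !memvZ // memv_span //.
by apply: allpairs_f; rewrite mem_nth // size_tuple.
Qed.

Lemma bracketv_subP (U W X : {vspace M}) :
  (bracketv U W <= X)%VS <->
  (forall u w : M, u \in U -> w \in W -> br u w \in X).
Proof.
split=> [/subvP sX u w Uu Ww | brX]; first exact/sX/memv_bracket.
apply/span_subvP => _ /allpairsP[[u w] /= [Uu Ww ->]].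
by apply: brX; apply: vbasis_mem.
Qed.

Definition derived_series (n : nat) : {vspace M} :=
  iter n (fun U => bracketv U U) fullv.

Definition solvable_algebra := exists n : nat, derived_series n = 0%VS.

End Algebras.

Section LeviCivita.
Variables (R : realType) (M : vectType R).
(* For theta = idfun, {dot M for theta} is the type of symmetric, positive
   definite bilinear forms on M. *)
Variables (br : {bilinear M -> M -> M}) (ip : {dot M for idfun}).

(* The vector u . v is the one satisfying the Koszul formula; the default 0
   of xget is never used, see levi_civitaE and levi_civita_unique. *)
Definition levi_civita (u v : M) : M :=
  xget 0 [set x : M | forall w : M,
    2 * ip x w = ip (br u v) w - ip (br v w) u + ip (br w u) v]%classic.

Lemma dot_inj (x y : M) : (forall w, ip x w = ip y w) -> x = y.
Proof.
move=> xy; apply/eqP; rewrite -subr_eq0; apply/negPn/negP => nz.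
  have := neq0_dnorm_gt0 (s := ip) _ nz.
by rewrite linearBl /= xy subrr ltxx.
Qed.

Lemma dot_riesz (l : {scalar M}) : exists x : M, forall w, ip x w = l w.
Proof.
pose f x : 'rV[R]_(\dim {:M}) := \row_j ip x (vbasis {:M})`_j.
have f_lin : linear f.
  by move=> a x y; apply/rowP => j; rewrite !mxE linearPl.
pose F := GRing.isLinear.Build _ _ _ _ f f_lin.
pose fL : {linear M -> _} := HB.pack f F.
have ext (g h : {scalar M}) :
    (forall j : 'I_(\dim {:M}), g (vbasis {:M})`_j = h (vbasis {:M})`_j) ->
    g =1 h.
  move=> gh w; rewrite (coord_vbasis (memvf w)) !linear_sum.
  by apply: eq_bigr => j _; rewrite !linearZ /= gh.
have f_inj : lker (linfun fL) == 0%VS.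
  apply/lker0P => x y; rewrite !lfunE /= => /rowP fxy.
  apply: dot_inj; apply: (ext (ip x) (ip y)) => j.
  by have := fxy j; rewrite !mxE.
have f_surj : limg (linfun fL) = fullv.
  apply/eqP; rewrite eqEdim subvf /= limg_dim_eq ?dimvf /=.
    by rewrite /dim /= mul1n.
  by rewrite (eqP f_inj) capv0.
have /memv_imgP[x _ fx] :
    \row_j l (vbasis {:M})`_j \in limg (linfun fL) by rewrite f_surj memvf.
exists x; apply: (ext (ip x) l) => j.
by move/rowP/(_ j): fx; rewrite lfunE !mxE => ->.
Qed.

Lemma levi_civitaE (u v w : M) :
  2 * ip (levi_civita u v) w =
  ip (br u v) w - ip (br v w) u + ip (br w u) v.
Proof.
pose l w : R := 2^-1 * (ip (br u v) w - ip (br v w) u + ip (br w u) v).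
have l_lin : scalar l.
  move=> a x y; rewrite /l linearPr linearPl linearPr /= !linearPl /=.
  by ring.
pose F := GRing.isLinear.Build _ _ _ _ l l_lin.
pose lL : {scalar M} := HB.pack l F.
have [x xP] := dot_riesz lL.
pose P : set M := [set x : M | forall w : M,
  2 * ip x w = ip (br u v) w - ip (br v w) u + ip (br w u) v]%classic.
have exP : exists x, P x.
  exists x => y; move: (xP y) => /= ->.
  by rewrite /l mulVKf ?pnatr_eq0.
exact: (xgetPex 0 exP w).
Qed.

Lemma levi_civita_unique (u v x : M) :
  (forall w, 2 * ip x w = ip (br u v) w - ip (br v w) u + ip (br w u) v) ->
  x = levi_civita u v.
Proof.
move=> xP; apply: dot_inj => w.
have /mulfI : (2 : R) != 0 by rewrite pnatr_eq0.
by apply; rewrite xP levi_civitaE.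
Qed.

Definition malcev_curvature (u v w : M) : M -> M :=
  let L := levi_civita in fun x =>
    L (br (br u v) w) x - L (br u w) (L v x) - L u (L (br v w) x)
    + L v (L u (L w x)) - L w (L v (L u x)).

Definition malcev_flat := forall u v w x : M, malcev_curvature u v w x = 0.

Definition lie_curvature (u v : M) : M -> M :=
  let L := levi_civita in fun x =>
    L (br u v) x - (L u (L v x) - L v (L u x)).

Definition lie_flat := forall u v x : M, lie_curvature u v x = 0.

End LeviCivita.

(* Main.v *)
From HB Require Import structures.
Require Import Defs.
From mathcomp Require Import all_boot all_order all_algebra.
From mathcomp Require Import reals.
From mathcomp Require Import ring lra.

(** A flat Euclidean Malcev algebra is one whose left multiplications [L u] for
    the Levi-Civita product are skew operators that represent the Malcev
    algebra.  The summands of the representation identity that are cubic in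
    [L] cancel under the trace, and [tr (L x) = 0]; what is left says that the
    trace form [B u v = tr (L u \o L v)] is invariant (lemma
    [trace_form_invariant]).  As the [L u] are skew, [- B u u] is a sum of
    squares, so [B] is definite modulo the kernel of [L].  A solvable algebra
    with such a form has all its brackets in that kernel
    ([solvable_bracket_in_radical]), hence [L (br u v) = 0].

    The flatness identity then loses every term with a bracket and becomes
    [L v \o L u \o L w = L w \o L v \o L u].  It makes [L a] and [L b]
    annihilate the commutator [C] of [L a] and [L b], so that [C \o C = 0]; as
    [C] is skew, [C = 0].  Thus both sides of [L (br u v) = [L u, L v]] vanish,
    which is flatness in the sense of Lie algebras, and the Jacobi identity
    follows as the first Bianchi identity of a torsion-free flat product. *)

Set Implicit Arguments.
Unset Strict Implicit.

Local Open Scope ring_scope.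
Import Order.TTheory GRing.Theory Num.Theory.

(** * Solvable algebras with an invariant form *)

Section InvariantForm.
Variables (R : realType) (M : vectType R) (br : {bilinear M -> M -> M}).
Hypothesis brC : anticommutative br.

Lemma derived_series_decreasing (n : nat) :
  (derived_series br n.+1 <= derived_series br n)%VS.
Proof.
elim: n => [|n IHn]; first exact: subvf.
by apply/bracketv_subP => u w Uu Ww; apply: memv_bracket; apply: (subvP IHn).
Qed.

Variables (N : {vspace M}) (B : M -> M -> R).
Hypothesis B_definite : forall x, B x x = 0 -> x \in N.
Hypothesis B_radical : forall u x, x \in N -> B u x = 0.
Hypothesis B_invariant : forall u v w, B (br u w) v = - B u (br v w).

(** With [U'] the derived space of [U], the hypothesis on the second derived
    space and invariance give [B (br u x) (br u x) = - B u (br (br u x) x) = 0]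
    for [x] in [U'], so [br U U'] lies in [N].  This makes the same computation
    work for every [x] in [U]. *)
Lemma bracket_in_radical_step (U : {vspace M}) :
  (bracketv br U U <= U)%VS ->
  (bracketv br (bracketv br U U) (bracketv br U U) <= N)%VS ->
  (bracketv br U U <= N)%VS.
Proof.
set U' := bracketv br U U => sU'U /bracketv_subP U''N.
have UU'N u x : u \in U -> x \in U' -> br u x \in N.
  move=> Uu U'x; apply: B_definite.
  rewrite B_invariant B_radical ?oppr0 //; apply: U''N => //.
  by apply: memv_bracket => //; apply: (subvP sU'U).
apply/bracketv_subP => u v Uu Uv; apply: B_definite.
rewrite B_invariant B_radical ?oppr0 // brC rpredN.
by apply: UU'N => //; apply: memv_bracket.
Qed.

(** Descent along the derived series, from the step where it reaches 0 down to
    the first derived space. *)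
Lemma solvable_bracket_in_radical :
  solvable_algebra br -> forall u v, br u v \in N.
Proof.
case=> n Dn0 u v.
have DnN : (derived_series br n.+1 <= N)%VS.
  by rewrite (subv_trans (derived_series_decreasing n)) // Dn0 sub0v.
suff D1N : (derived_series br 1 <= N)%VS.
  by apply: (subvP D1N); apply: memv_bracket; apply: memvf.
elim: n DnN {Dn0} => // n IHn DnN; apply: IHn.
by apply: bracket_in_radical_step; first exact: derived_series_decreasing.
Qed.

End InvariantForm.

(** * Parseval frames *)

Section ParsevalFrame.
Variables (R : realType) (M : vectType R) (ip : {dot M for idfun}).

Lemma dotC (x y : M) : ip x y = ip y x.
Proof. by rewrite hermC /= expr0 mul1r. Qed.

Lemma dot_eq0 (x : M) : ip x x = 0 -> x = 0.
Proof.
move=> xx0; apply/eqP/negPn/negP => nz.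
by have := neq0_dnorm_gt0 (s := ip) _ nz; rewrite xx0 ltxx.
Qed.

(** In such a frame the matrices [ip (f e_i) e_j] of operators [f] turn
    compositions into products, and skew operators have skew matrices, so it
    serves as an orthonormal basis for computing traces.  To build it, split off
    a unit vector [e] of [V] and continue in the part of [V] orthogonal to
    [e]. *)
Lemma parseval_frame_sub (V : {vspace M}) :
  exists s : seq M, {subset s <= V} /\
    forall x, x \in V -> x = \sum_(e <- s) ip x e *: e.
Proof.
have [n] := ubnP (\dim V); elim: n V => // n IHn V /[!ltnS] dimV.
have [->|V_neq0] := eqVneq V 0%VS.
  by exists [::]; split=> // x; rewrite big_nil memv0 => /eqP.
have [e Ve ee1] : exists2 e, e \in V & ip e e = 1.
  pose v := vpick V; exists ((Num.sqrt (ip v v))^-1 *: v).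
    by rewrite memvZ // memv_pick.
  have v_neq0 : v != 0 by rewrite vpick0.
  have vv_gt0 : 0 < ip v v := neq0_dnorm_gt0 (s := ip) _ v_neq0.
  rewrite linearZl_LR linearZr_LR /= mulrA -expr2 exprVn.
  by rewrite sqr_sqrtr ?ltW // mulVf // gt_eqF.
pose V' := (V :&: orthov ip <[e]>)%VS.
have V'P x : (x \in V') = (x \in V) && (ip x e == 0).
  by rewrite memv_cap mem_orthov1.
have dimV' : (\dim V' < n)%N.
  apply: leq_trans dimV.
  have sV'V : (V' <= V)%VS by apply: capvSl.
  rewrite ltn_neqAle dimvS // andbT; apply/negP => dimE.
  have /eqP V'V : V' == V by rewrite eqEdim sV'V (eqP dimE) /=.
  by move: (Ve); rewrite -V'V V'P ee1 oner_eq0 andbF.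
have [s [sV' sP]] := IHn V' dimV'.
exists (e :: s); split=> [x|x Vx].
  by rewrite inE => /predU1P[-> // | /sV']; rewrite V'P => /andP[].
have V'y : x - ip x e *: e \in V'.
  rewrite V'P rpredB ?memvZ //= linearBl linearZl_LR /= ee1 mulr1.
  by rewrite subrr.
rewrite big_cons -[LHS](subrK (ip x e *: e)) addrC (sP _ V'y).
congr (_ + _); rewrite !big_seq; apply: eq_bigr => f /sV'.
rewrite V'P => /andP[_ /eqP fe0].
by rewrite linearBl linearZl_LR /= (dotC e) fe0 mulr0 subr0.
Qed.

Lemma parseval_frame :
  exists s : seq M, forall x, x = \sum_(e <- s) ip x e *: e.
Proof.
have [s [_ sP]] := parseval_frame_sub fullv.
by exists s => x; apply: sP; rewrite memvf.
Qed.

End ParsevalFrame.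

(** * The Levi-Civita product *)

Section LeviCivitaTheory.
Variables (R : realType) (M : vectType R).
Variables (br : {bilinear M -> M -> M}) (ip : {dot M for idfun}).
Hypothesis brC : anticommutative br.

Local Notation L := (levi_civita br ip).

Lemma levi_civita_is_linear_l (x : M) : linear (L^~ x).
Proof.
move=> a u v; apply/esym/levi_civita_unique => w.
rewrite !(linearPl, linearPr) /= ?linearPl /=.
by rewrite mulrDr mulrCA !levi_civitaE; ring.
Qed.

Lemma levi_civita_is_linear_r (u : M) : linear (L u).
Proof.
move=> a x y; apply/esym/levi_civita_unique => w.
rewrite !(linearPl, linearPr) /= ?linearPl /=.
by rewrite mulrDr mulrCA !levi_civitaE; ring.
Qed.

HB.instance Definition _ :=
  bilinear_isBilinear.Build R M M M _ _ L
    (levi_civita_is_linear_l, levi_civita_is_linear_r).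

Lemma levi_civita_skew (u x y : M) : ip (L u x) y = - ip x (L u y).
Proof.
apply: (mulfI (x := 2)); first by rewrite pnatr_eq0.
rewrite mulrN [ip x _]dotC !levi_civitaE.
rewrite (brC u y) (brC y x) (brC x u) !linearNl /=; ring.
Qed.

Lemma levi_civita_torsion_free (u v : M) : L u v - L v u = br u v.
Proof.
apply: (@dot_inj _ _ ip) => w.
apply: (mulfI (x := 2)); first by rewrite pnatr_eq0.
rewrite linearBl /= mulrBr !levi_civitaE.
rewrite (brC v u) (brC w v) (brC w u) !linearNl /=; ring.
Qed.

(** The first Bianchi identity: for a torsion-free product the cyclic sum of the
    curvature is the Jacobian of the commutator. *)
Lemma lie_flat_jacobi : lie_flat br ip -> forall u v w, jacobian br u v w = 0.
Proof.
move=> flat u v w; rewrite /jacobian.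
have flatE a b x : L (br a b) x = L a (L b x) - L b (L a x).
  by apply/eqP; rewrite -subr_eq0; apply/eqP/flat.
have brbrE a b c : br (br a b) c =
    L a (L b c) - L b (L a c) - (L c (L a b) - L c (L b a)).
  by rewrite -levi_civita_torsion_free flatE -levi_civita_torsion_free linearBr.
apply: (@dot_inj _ _ ip) => y.
by rewrite !brbrE !(linearDl, linearNl) linear0l /=; ring.
Qed.

End LeviCivitaTheory.

(** * The trace form of a flat Malcev algebra *)

Section TraceForm.
Variables (R : realType) (M : vectType R).
Variables (br : {bilinear M -> M -> M}) (ip : {dot M for idfun}).
Hypothesis brC : anticommutative br.

Local Notation L := (levi_civita br ip).

Variable s : seq M.
Hypothesis sP : forall x, x = \sum_(e <- s) ip x e *: e.

Definition frame_mx (f : M -> M) : 'M[R]_(size s) :=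
  \matrix_(i, j) ip (f s`_i) s`_j.

(** Rows are images of frame vectors, so matrices multiply in the order opposite
    to composition. *)
Lemma frame_mx_comp (f : M -> M) (u : M) :
  frame_mx (L u \o f) = frame_mx f *m frame_mx (L u).
Proof.
apply/matrixP => i k; rewrite !mxE /= {1}(sP (f s`_i)) linear_sumr.
rewrite linear_sumlz (big_nth 0) big_mkord.
by apply: eq_bigr => j _; rewrite !mxE linearZr_LR linearZl_LR.
Qed.

Definition levi_civita_mx (u : M) : 'M[R]_(size s) := frame_mx (L u).

Lemma levi_civita_mx_is_linear : linear levi_civita_mx.
Proof.
by move=> a u v; apply/matrixP => i j; rewrite !mxE !linearPl.
Qed.

HB.instance Definition _ :=
  GRing.isLinear.Build R M 'M[R]_(size s) _ levi_civita_mx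
    levi_civita_mx_is_linear.

Lemma levi_civita_mx_eq0 (u : M) : levi_civita_mx u = 0 -> forall x, L u x = 0.
Proof.
move=> A0 x; rewrite (sP x) linear_sumr big_seq big1 // => e.
case/(nthP 0) => i lti <-.
rewrite linearZr_LR /= [L u _]sP (big_nth 0) big_mkord big1 ?scaler0 // => j _.
have /matrixP/(_ (Ordinal lti) j) := A0.
by rewrite !mxE /= => ->; rewrite scale0r.
Qed.

Lemma trmx_levi_civita_mx (u : M) : (levi_civita_mx u)^T = - levi_civita_mx u.
Proof.
by apply/matrixP => i j; rewrite !mxE levi_civita_skew // dotC.
Qed.

Lemma mxtrace_levi_civita_mx (u : M) : \tr (levi_civita_mx u) = 0.
Proof.
have := mxtrace_tr (levi_civita_mx u).
rewrite trmx_levi_civita_mx raddfN /=; lra.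
Qed.

Definition trace_form (u v : M) : R :=
  \tr (levi_civita_mx u *m levi_civita_mx v).

(** The matrix [A] of [L u] is skew, so [\tr (A *m A)] is minus the sum of the
    squares of its entries. *)
Lemma trace_form_definite (u : M) : trace_form u u = 0 -> levi_civita_mx u = 0.
Proof.
move=> uu0; have {uu0} : \tr (levi_civita_mx u *m (levi_civita_mx u)^T) = 0.
  by rewrite trmx_levi_civita_mx mulmxN raddfN /= [\tr _]uu0 oppr0.
have sq_ge0 i : 0 <= \sum_j levi_civita_mx u i j ^+ 2.
  by apply: sumr_ge0 => j _; apply: sqr_ge0.
rewrite /mxtrace; under eq_bigr => i _.
  rewrite mxE; under eq_bigr => j _ do rewrite [_^T _ _]mxE -expr2; over.
move=> /eqP; rewrite psumr_eq0 // => /allP rows0.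
apply/matrixP => i j; rewrite [RHS]mxE; apply/eqP.
have := rows0 i (mem_index_enum i); rewrite psumr_eq0 => [/allP row0|k _].
  by have := row0 j (mem_index_enum j); rewrite sqrf_eq0.
exact: sqr_ge0.
Qed.

(** In the trace of the flatness identity the two cubic terms are equal by
    cyclicity, and [L] of a bracket has trace 0. *)
Lemma trace_form_invariant : malcev_flat br ip ->
  forall u v w, trace_form (br u w) v = - trace_form u (br v w).
Proof.
move=> flat u v w.
pose A := levi_civita_mx.
have : A (br (br u v) w) - A v *m A (br u w) - A (br v w) *m A u
    + A w *m A u *m A v - A u *m A v *m A w = 0.
  rewrite /A /levi_civita_mx -!frame_mx_comp.
  apply/matrixP => i j; have := congr1 (ip^~ s`_j) (flat u v w s`_i).
  by rewrite /malcev_curvature !(linearDl, linearNl) linear0l /= !mxE.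
move/(congr1 mxtrace); rewrite !(raddfB, raddfD) /= raddf0.
rewrite mxtrace_levi_civita_mx -[A w *m A u *m A v]mulmxA.
rewrite (mxtrace_mulC (A w)) /trace_form -/A.
rewrite (mxtrace_mulC (A v)) (mxtrace_mulC (A (br v w))); lra.
Qed.

End TraceForm.

(** * Flat solvable Malcev algebras *)

Section FlatSolvable.
Variables (R : realType) (M : vectType R).
Variables (br : {bilinear M -> M -> M}) (ip : {dot M for idfun}).
Hypothesis brC : anticommutative br.
Hypothesis flat : malcev_flat br ip.

Local Notation L := (levi_civita br ip).

Lemma levi_civita_bracket_eq0 :
  solvable_algebra br -> forall u v x, L (br u v) x = 0.
Proof.
move=> solv u v; have [s sP] := parseval_frame ip.
apply: (levi_civita_mx_eq0 sP).
pose N := lker (linfun (levi_civita_mx br ip s)).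
have NP x : (x \in N) = (levi_civita_mx br ip s x == 0).
  by rewrite memv_ker lfunE.
apply/eqP; rewrite -NP.
pose B := trace_form br ip s.
apply: (solvable_bracket_in_radical brC (N := N) (B := B)) => //.
- by move=> x xx0; rewrite NP (trace_form_definite brC xx0).
- by move=> y x; rewrite NP /B /trace_form => /eqP->; rewrite mulmx0 raddf0.
- exact: trace_form_invariant.
Qed.

Hypothesis L_br : forall u v x, L (br u v) x = 0.

(** What flatness says once [L] kills the brackets: a product of three left
    multiplications is invariant under cyclic permutation. *)
Lemma levi_civita_cyclic (u v w x : M) : L v (L u (L w x)) = L w (L v (L u x)).
Proof.
have := flat u v w x; rewrite /malcev_curvature !L_br linear0r !subr0 add0r.
by move/eqP; rewrite subr_eq0 => /eqP.
Qed.

(** By cyclicity [L a] and [L b] annihilate the commutator [C] of [L a] and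
    [L b]; a skew operator of square 0 is 0. *)
Lemma levi_civita_commute (a b x : M) : L a (L b x) = L b (L a x).
Proof.
pose C y := L a (L b y) - L b (L a y).
have aC0 y : L a (C y) = 0.
  by rewrite /C linearBr /= (levi_civita_cyclic b a a) subrr.
have bC0 y : L b (C y) = 0.
  by rewrite /C linearBr /= (levi_civita_cyclic a b b) subrr.
(* C is skew, so this is the vanishing of the inner product of x and C (C x). *)
have CC0 : ip (C x) (C x) = 0.
  rewrite {2}/C linearBr /= ![ip (C x) _]dotC.
  by rewrite !levi_civita_skew // aC0 bC0 !linear0r !oppr0 addr0.
by apply/eqP; rewrite -subr_eq0; apply/eqP/(dot_eq0 (ip := ip)).
Qed.

End FlatSolvable.

Theorem corollary2p22 (R : realType) (M : vectType R)
    (br : {bilinear M -> M -> M}) (ip : {dot M for idfun}) :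
  malcev_algebra br -> solvable_algebra br -> malcev_flat br ip ->
  lie_algebra br /\ lie_flat br ip.
Proof.
move=> [brC _] solv flat.
have L_br := levi_civita_bracket_eq0 brC flat solv.
have lflat : lie_flat br ip.
  move=> u v x; rewrite /lie_curvature L_br.
  by rewrite (levi_civita_commute brC flat L_br u v) subrr subr0.
by split=> //; split=> //; apply: lie_flat_jacobi lflat.
Qed.
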